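(* Let $A\subseteq B$ be an extension of integral domains and let $K$ be the quotient field of $A$. For $\star\in\mathrm{SStar}(B)$ let $\sigma(\star)\in\mathrm{SStar}(A)$ be the semistar operation on $A$ defined by $F^{\sigma(\star)}:=(FB)^\star\cap K$ for every nonzero $A$-submodule $F$ of $K$, and let $\sigma:\mathrm{SStar}(B)\to\mathrm{SStar}(A)$ be the resulting map $\star\mapsto\sigma(\star)$. Then: (1) The map $\sigma$ is continuous (for the Zariski topologies). (2) If $\star\in\mathrm{SStar}(B)$ is of finite type, then so is $\sigma(\star)$; i.e., $\sigma$ restricts to a map $\mathrm{SStar}_f(B)\to\mathrm{SStar}_f(A)$.
   Context: For an integral domain $R$ with quotient field $Q$: $\overline{\mathbf F}(R)$ is the set of all nonzero $R$-submodules of $Q$, and $\mathbf f(R)$ is the set of all nonzero finitely generated $R$-submodules of $Q$. A semistar operation on $R$ is a map $\star:\overline{\mathbf F}(R)\to\overline{\mathbf F}(R)$, $F\mapsto F^\star$, such that for all nonzero $k\in Q$ and all $F,G\in\overline{\mathbf F}(R)$: $(kF)^\star=kF^\star$; $F\subseteq G$ implies $F^\star\subseteq G^\star$; $F\subseteq F^\star$; $(F^\star)^\star=F^\star$. $\mathrm{SStar}(R)$ is the set of all semistar operations on $R$, endowed with the Zariski topology, which has as a subbasis of open sets the sets $V_F^{(R)}:=\{\star\in\mathrm{SStar}(R):1\in F^\star\}$, for $F\in\overline{\mathbf F}(R)$. A semistar operation $\star$ on $R$ is of finite type if $F^\star=\bigcup\{G^\star:G\in\mathbf f(R),\,G\subseteq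 F\}$ for every $F\in\overline{\mathbf F}(R)$; $\mathrm{SStar}_f(R)$ is the set of semistar operations of finite type on $R$. The quotient field $K$ of $A$ is regarded as a subfield of the quotient field of $B$. *)

(* Defs.v *)
From HB Require Import structures.
From mathcomp Require Import all_boot all_order all_algebra.
From mathcomp Require Import all_classical topology_structure.

Set Implicit Arguments.
Unset Strict Implicit.
Unset Printing Implicit Defensive.

Import GRing.Theory.

Local Open Scope classical_set_scope.
Local Open Scope ring_scope.

Notation "x %:F" := (@FracField.tofrac _ x) : ring_scope.

Section FracModule.
Variable R : idomainType.

Definition frac_scale (a : R) (x : {fraction R}) : {fraction R} := a%:F * x.

Fact frac_scaleA a b v :
  frac_scale a (frac_scale b v) = frac_scale (a * b) v.
Proof. by rewrite /frac_scale tofracM mulrA. Qed.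

Fact frac_scale1 : left_id 1 frac_scale.
Proof. by move=> v; rewrite /frac_scale tofrac1 mul1r. Qed.

Fact frac_scaleDr : right_distributive frac_scale +%R.
Proof. by move=> a u v; rewrite /frac_scale mulrDr. Qed.

Fact frac_scaleDl v : {morph frac_scale^~ v : a b / a + b}.
Proof. by move=> a b; rewrite /frac_scale tofracD mulrDl. Qed.

HB.instance Definition _ := GRing.Zmodule_isLmodule.Build R {fraction R}
  frac_scaleA frac_scale1 frac_scaleDr frac_scaleDl.

Lemma frac_scaleE (a : R) (x : {fraction R}) : a *: x = a%:F * x.
Proof. by []. Qed.

End FracModule.

Section Submodules.
Variable R : idomainType.
Local Notation Q := {fraction R}.

(* The elements of $\overline{\mathbf F}(R)$. *)
Record Fbar := MkFbar {
  Fbar_set :> set Q;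
  Fbar_submod : submod_closed [in Fbar_set];
  Fbar_neq0 : exists2 x, Fbar_set x & x != 0 }.

Lemma Fbar_ext (F G : Fbar) : F = G :> set Q -> F = G.
Proof.
case: F G => [F F1 F2] [G G1 G2] /= FG; rewrite -{}FG in G1 G2 *.
by rewrite (Prop_irrelevance F1 G1) (Prop_irrelevance F2 G2).
Qed.

Lemma submodP (S : set Q) : submod_closed [in S] <->
  S 0 /\ (forall (a : R) x y, S x -> S y -> S (a *: x + y)).
Proof.
split=> -[S0 SL]; split.
- by move: S0; rewrite !inE.
- by move=> a x y Sx Sy; have := SL a x y; rewrite !inE; apply.
- by rewrite !inE.
- by move=> a x y; rewrite !inE; exact: SL.
Qed.

Lemma Fbar0 (F : Fbar) : Fbar_set F 0.
Proof. by have /submodP[] := Fbar_submod F. Qed.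

Lemma FbarD (F : Fbar) x y :
  Fbar_set F x -> Fbar_set F y -> Fbar_set F (x + y).
Proof.
by have /submodP[_ FL] := Fbar_submod F => /(FL 1 x y); rewrite scale1r; apply.
Qed.

Lemma FbarZ (F : Fbar) (a : R) x : Fbar_set F x -> Fbar_set F (a *: x).
Proof.
have /submodP[F0 FL] := Fbar_submod F.
by move=> Fx; rewrite -[_ *: _]addr0; apply: FL.
Qed.

Lemma Fbar_sum (F : Fbar) n (x : 'I_n -> Q) :
  (forall i, Fbar_set F (x i)) -> Fbar_set F (\sum_i x i).
Proof.
move=> Fx; apply: (big_ind (Fbar_set F)) => //.
- exact: Fbar0.
- exact: FbarD.
Qed.

Definition lincomb (X : set Q) : set Q :=
  [set y | exists (n : nat) (c : 'I_n -> R) (x : 'I_n -> Q),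
      (forall i, X (x i)) /\ y = \sum_i c i *: x i].

Lemma sub_lincomb (X : set Q) : X `<=` lincomb X.
Proof.
move=> x Xx; exists 1%N, (fun=> 1), (fun=> x); split=> //.
by rewrite big_ord1 scale1r.
Qed.

Lemma lincomb_submod (X : set Q) : submod_closed [in lincomb X].
Proof.
apply/submodP; split=> [|a _ _ [n [c [x [Xx ->]]]] [m [d [y [Xy ->]]]]].
  exists 0%N, (fun=> 0), (fun=> 0); split=> [[]//|]; by rewrite big_ord0.
exists (n + m)%N,
  (fun i => match fintype.split i with inl j => a * c j | inr j => d j end),
  (fun i => match fintype.split i with inl j => x j | inr j => y j end).
split=> [i|]; first by case: fintype.split.
rewrite big_split_ord /= scaler_sumr; congr (_ + _); apply: eq_bigr => i _.
  by rewrite -[lshift _ _]/(unsplit (inl i)) unsplitK scalerA.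
by rewrite -[rshift _ _]/(unsplit (inr i)) unsplitK.
Qed.

Lemma lincomb_min (X : set Q) (F : Fbar) : X `<=` F -> lincomb X `<=` F.
Proof.
move=> XF _ [n [c [x [Xx ->]]]]; apply: Fbar_sum => i.
by apply: FbarZ; apply: XF.
Qed.

Definition fin_gen (F : Fbar) : Prop :=
  exists2 X : set Q, finite_set X & F = lincomb X :> set Q.

Fact Fbar_full_submod : submod_closed [in [set: Q]].
Proof. exact/submodP. Qed.

Fact Fbar_full_neq0 : exists2 x : Q, [set: Q] x & x != 0.
Proof. by exists 1 => //; exact: oner_neq0. Qed.

Definition Fbar_full : Fbar := MkFbar Fbar_full_submod Fbar_full_neq0.

Section Scale.
Variables (k : Q) (k0 : k != 0) (F : Fbar).

Fact Fbar_scale_submod : submod_closed [in [set k * x | x in F]].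
Proof.
apply/submodP; split; first by exists 0; [exact: Fbar0|rewrite mulr0].
move=> a _ _ [x Fx <-] [y Fy <-]; exists (a *: x + y).
  by apply: FbarD => //; exact: FbarZ.
by rewrite mulrDr !frac_scaleE mulrCA.
Qed.

Fact Fbar_scale_neq0 : exists2 x : Q, [set k * x | x in F] x & x != 0.
Proof.
have [x Fx x0] := Fbar_neq0 F.
by exists (k * x); [exists x | rewrite mulf_neq0].
Qed.

Definition Fbar_scale : Fbar := MkFbar Fbar_scale_submod Fbar_scale_neq0.

End Scale.

HB.instance Definition _ := gen_eqMixin Fbar.
HB.instance Definition _ := gen_choiceMixin Fbar.
HB.instance Definition _ := isPointed.Build Fbar Fbar_full.

End Submodules.

Section Semistar.
Variable R : idomainType.

Record SStar := MkSStar {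
  sstar_op :> Fbar R -> Fbar R;
  sstarZ : forall (k : {fraction R}) (k0 : k != 0) (F : Fbar R),
    sstar_op (Fbar_scale k0 F) = Fbar_scale k0 (sstar_op F);
  sstar_le : forall F G : Fbar R, F `<=` G -> sstar_op F `<=` sstar_op G;
  sstar_ext : forall F : Fbar R, F `<=` sstar_op F;
  sstar_idem : forall F : Fbar R, sstar_op (sstar_op F) = sstar_op F }.

HB.instance Definition _ := gen_eqMixin SStar.
HB.instance Definition _ := gen_choiceMixin SStar.

Definition zariski_subbase (F : Fbar R) : set SStar :=
  [set s : SStar | Fbar_set (s F) 1].

HB.instance Definition _ := @isSubBaseTopological.Build SStar
  (Fbar R) [set: Fbar R] zariski_subbase.

Definition finite_type (s : SStar) : Prop :=
  forall F : Fbar R, s F =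
    \bigcup_(G in [set G : Fbar R | fin_gen G /\ G `<=` F]) s G
    :> set {fraction R}.

End Semistar.

Section FracMap.
Variables (A B : idomainType) (f : {rmorphism A -> B}) (f_inj : injective f).

(* The embedding $a/b \mapsto f(a)/f(b)$ of quotient fields; injectivity of
   [f] makes it independent of the representative chosen by [repr]. *)
Definition frac_map of injective f := fun q : {fraction A} =>
  (f (\n_(repr q)))%:F / (f (\d_(repr q)))%:F.

Lemma frac_numden (q : {fraction A}) :
  q = (\n_(repr q))%:F / (\d_(repr q))%:F.
Proof.
have d0 : (\d_(repr q))%:F != 0 :> {fraction A}.
  by rewrite tofrac_eq0; exact: denom_ratioP.
apply: (canRL (mulfK d0)); rewrite -{1}[q]reprK.
rewrite /FracField.tofrac; unlock.
rewrite -[LHS](FracField.pi_mul (repr q) (Ratio (\d_(repr q)) 1)).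
apply/eqmodP => /=; rewrite /FracField.equivf /FracField.mulf.
have r0 := denom_ratioP (repr q).
by rewrite !numden_Ratio ?oner_neq0 ?mulr1 // mulrC.
Qed.

Let fnz (a : A) : a != 0 -> (f a)%:F != 0 :> {fraction B}.
Proof. by rewrite tofrac_eq0 -(rmorph0 f) inj_eq. Qed.

Lemma frac_map_div (a b : A) : b != 0 ->
  frac_map f_inj (a%:F / b%:F) = (f a)%:F / (f b)%:F.
Proof.
move=> b0; rewrite /frac_map; set q := a%:F / _.
have d0 := denom_ratioP (repr q).
apply/eqP; rewrite eqr_div ?fnz //; apply/eqP.
rewrite -!tofracM -!rmorphM; congr (f _)%:F.
apply/eqP; rewrite -tofrac_eq !tofracM -eqr_div ?tofrac_eq0 //.
by rewrite -frac_numden.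
Qed.

Lemma frac_map_tofrac (a : A) : frac_map f_inj a%:F = (f a)%:F.
Proof.
have := @frac_map_div a 1 (oner_neq0 _).
by rewrite rmorph1 !tofrac1 !divr1.
Qed.

Fact frac_map_is_zmod_morphism : zmod_morphism (frac_map f_inj).
Proof.
move=> p q; rewrite [in LHS](frac_numden p) [in LHS](frac_numden q).
have p0 := denom_ratioP (repr p); have q0 := denom_ratioP (repr q).
rewrite -mulNr addf_div ?tofrac_eq0 // -tofracN -!tofracM -tofracD.
rewrite frac_map_div ?mulf_neq0 // /frac_map -[in RHS]mulNr addf_div ?fnz //.
by rewrite !(rmorphD, rmorphM, rmorphN, tofracD, tofracM, tofracN).
Qed.

Fact frac_map_is_monoid_morphism : monoid_morphism (frac_map f_inj).
Proof.
split=> [|p q].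
  by have := frac_map_tofrac 1; rewrite rmorph1 !tofrac1.
rewrite [in LHS](frac_numden p) [in LHS](frac_numden q).
have p0 := denom_ratioP (repr p); have q0 := denom_ratioP (repr q).
rewrite mulf_div -!tofracM frac_map_div ?mulf_neq0 // /frac_map.
by rewrite !(rmorphM, tofracM) mulf_div.
Qed.

HB.instance Definition _ := GRing.isZmodMorphism.Build
  {fraction A} {fraction B} (frac_map f_inj) frac_map_is_zmod_morphism.
HB.instance Definition _ := GRing.isMonoidMorphism.Build
  {fraction A} {fraction B} (frac_map f_inj) frac_map_is_monoid_morphism.

Lemma frac_mapZ (a : A) (x : {fraction A}) :
  frac_map f_inj (a *: x) = f a *: frac_map f_inj x.
Proof. by rewrite !frac_scaleE rmorphM /= frac_map_tofrac. Qed.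

End FracMap.

Section Sigma.
Variables (A B : idomainType) (f : {rmorphism A -> B}) (f_inj : injective f).
Local Notation phi := (frac_map f_inj).

Section Extend.
Variable F : Fbar A.

Fact extend_neq0 : exists2 x, lincomb (phi @` F) x & x != 0.
Proof.
have [x Fx x0] := Fbar_neq0 F; exists (phi x); last by rewrite fmorph_eq0.
by apply: sub_lincomb; exists x.
Qed.

(* $FB$ *)
Definition extend : Fbar B := MkFbar (lincomb_submod (phi @` F)) extend_neq0.

End Extend.

Lemma sub_extend (F : Fbar A) x :
  Fbar_set F x -> Fbar_set (extend F) (phi x).
Proof. by move=> Fx; apply: sub_lincomb; exists x. Qed.

Lemma extend_le (F : Fbar A) (G : Fbar B) :
  (forall x, Fbar_set F x -> Fbar_set G (phi x)) -> extend F `<=` G.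
Proof. by move=> FG; apply: lincomb_min => _ [x Fx <-]; exact: FG. Qed.

Lemma extendZ (k : {fraction A}) (k0 : k != 0) (k0' : phi k != 0)
  (F : Fbar A) : extend (Fbar_scale k0 F) = Fbar_scale k0' (extend F).
Proof.
apply/Fbar_ext/seteqP; split.
  apply: extend_le => _ [x Fx <-]; exists (phi x); last by rewrite rmorphM.
  exact: sub_extend.
move=> _ [_ [n [c [x [Fx ->]]]] <-].
exists n, c, (fun i => phi k * x i); split=> [i|].
  have [y Fy <-] := Fx i.
  by exists (k * y); [exists y|rewrite rmorphM].
by rewrite mulr_sumr; apply: eq_bigr => i _; rewrite !frac_scaleE mulrCA.
Qed.

Section SigmaOp.
Variable s : SStar B.

Section Op.
Variable F : Fbar A.

Fact sigma_submod : submod_closed [in phi @^-1` s (extend F)].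
Proof.
apply/submodP; split=> [|a x y].
  by rewrite /preimage/= rmorph0; exact: Fbar0.
rewrite /preimage/= rmorphD /= frac_mapZ => sx sy.
by apply: FbarD => //; exact: FbarZ.
Qed.

Fact sigma_neq0 : exists2 x, (phi @^-1` s (extend F)) x & x != 0.
Proof.
have [x Fx x0] := Fbar_neq0 F; exists x => //.
by apply/sstar_ext/sub_extend.
Qed.

(* $(FB)^\star \cap K$ *)
Definition sigma_op : Fbar A := MkFbar sigma_submod sigma_neq0.

End Op.

Fact sigmaZ (k : {fraction A}) (k0 : k != 0) (F : Fbar A) :
  sigma_op (Fbar_scale k0 F) = Fbar_scale k0 (sigma_op F).
Proof.
have k0' : phi k != 0 by rewrite fmorph_eq0.
apply/Fbar_ext; rewrite /= (extendZ k0 k0') sstarZ.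
apply/seteqP; split=> [x [y sy yx]|_ [x sx <-]].
  exists (k^-1 * x); last by rewrite mulVKf.
  by rewrite /preimage/= rmorphM fmorphV /= -yx mulKf.
by exists (phi x) => //; rewrite rmorphM.
Qed.

Fact sigma_le (F G : Fbar A) : F `<=` G -> sigma_op F `<=` sigma_op G.
Proof.
move=> FG x; apply: sstar_le; apply: extend_le => y Fy.
exact/sub_extend/FG.
Qed.

Fact sigma_ext (F : Fbar A) : F `<=` sigma_op F.
Proof. by move=> x Fx; apply/sstar_ext/sub_extend. Qed.

Fact sigma_idem (F : Fbar A) : sigma_op (sigma_op F) = sigma_op F.
Proof.
apply/Fbar_ext/seteqP; split; last exact: sigma_ext.
have le : extend (sigma_op F) `<=` s (extend F) by exact: extend_le.
by move=> x sx; have := sstar_le le sx; rewrite sstar_idem.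
Qed.

Definition sigma : SStar A := MkSStar sigmaZ sigma_le sigma_ext sigma_idem.

End SigmaOp.
End Sigma.

(* Main.v *)
Require Import Defs.
From HB Require Import structures.
From mathcomp Require Import all_boot all_order all_algebra.
From mathcomp Require Import all_classical topology_structure.

Set Implicit Arguments.
Unset Strict Implicit.
Unset Printing Implicit Defensive.

Import GRing.Theory.

Local Open Scope classical_set_scope.
Local Open Scope ring_scope.

(** Both parts say that the extension of modules $F \mapsto FB$ transports the
    relevant structure from $A$ to $B$.

    Continuity: since $1 \in K$, the condition $1 \in (FB)^\star \cap K$ just
    means $1 \in (FB)^\star$, so the preimage under $\sigma$ of the subbasic
    open set of $F$ is the subbasic open set of $FB$
    ([preimage_zariski_subbase]); checking preimages on a subbase suffices
    ([continuous_zariski_subbase]).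

    Finite type: let $x \in (FB)^\star \cap K$. As $\star$ is of finite type,
    $x \in G^\star$ for a finitely generated $G \subseteq FB$. Each of the
    finitely many generators of $G$ is a $B$-linear combination of finitely
    many elements of $F$, so there is a finitely generated $H \subseteq F$ with
    $G \subseteq HB$ ([fin_gen_sub_extend]), whence
    $x \in (HB)^\star \cap K = H^{\sigma(\star)}$. The reverse inclusion is
    monotonicity. *)

Section Zariski.
Variable R : idomainType.

Lemma open_zariski_subbase (F : Fbar R) : open (zariski_subbase F).
Proof.
exists [set zariski_subbase F]; last by rewrite bigcup_set1.
by move=> _ ->; exact: finI_from1.
Qed.

Lemma continuous_zariski_subbase (T : topologicalType) (g : T -> SStar R) :
  (forall F, open (g @^-1` zariski_subbase F)) -> continuous g.
Proof.
move=> g_open; apply/continuousP => _ [U sU <-].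
rewrite preimage_bigcup; apply: bigcup_open => _ /sU[E _ <-].
rewrite preimage_bigcap bigcap_fset.
by apply: big_ind => [|| F _]; [exact: openT | exact: openI | exact: g_open].
Qed.

End Zariski.

Section FinitelyGenerated.
Variable R : idomainType.
Local Notation Q := {fraction R}.

Lemma lincomb_le (X Y : set Q) : X `<=` Y -> lincomb X `<=` lincomb Y.
Proof.
by move=> XY y [n [c [x [Xx ->]]]]; exists n, c, x; split=> // i; exact: XY.
Qed.

(** A linear combination has only finitely many terms. The index set [S] is
    kept apart from its image so that the finite subset is found in [S] itself:
    it will have to span a module over a smaller ring than the one acting
    here. *)
Lemma lincomb_image_finite (T : Type) (g : T -> Q) (S : set T) (y : Q) :
  lincomb (g @` S) y ->
  exists X : set T, [/\ finite_set X, X `<=` S & lincomb (g @` X) y].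
Proof.
move=> [n [c [x [Sx ->]]]].
have /choice[t St] i : exists t, S t /\ g t = x i.
  by have [t] := Sx i; exists t.
exists (range t); split; first exact: finite_image.
  by move=> _ [i _ <-]; have [] := St i.
by exists n, c, x; split=> // i; exists (t i); [exists i | have [] := St i].
Qed.

Lemma finite_sub_lincomb_image (T : Type) (g : T -> Q) (S : set T) (Y : set Q) :
  finite_set Y -> Y `<=` lincomb (g @` S) ->
  exists X : set T, [/\ finite_set X, X `<=` S & Y `<=` lincomb (g @` X)].
Proof.
move=> finY YS.
have /choice[X XP] y : exists X : set T,
    Y y -> [/\ finite_set X, X `<=` S & lincomb (g @` X) y].
  have [Yy|nYy] := pselect (Y y); last by exists set0.
  by have [X] := lincomb_image_finite (YS y Yy); exists X.
exists (\bigcup_(y in Y) X y); split.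
- by apply: bigcup_finite => // y /XP[].
- by apply: bigcup_sub => y /XP[].
- move=> y Yy; have [_ _] := XP y Yy; apply: lincomb_le.
  by apply: image_subset; exact: bigcup_sup.
Qed.

(** The given nonzero [x] witnesses that the span is a nonzero module, as
    membership in [Fbar R] requires. *)
Lemma fin_gen_span (X : set Q) (x : Q) : finite_set X -> X x -> x != 0 ->
  exists2 H : Fbar R, fin_gen H & H = lincomb X :> set Q.
Proof.
move=> finX Xx x0.
have nz : exists2 x, lincomb X x & x != 0 by exists x; [exact: sub_lincomb|].
by exists (MkFbar (lincomb_submod X) nz); [exists X|].
Qed.

End FinitelyGenerated.

Section Sigma.
Variables (A B : idomainType) (f : {rmorphism A -> B}) (f_inj : injective f).

Lemma preimage_zariski_subbase (F : Fbar A) :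
  sigma f_inj @^-1` zariski_subbase F = zariski_subbase (extend f_inj F).
Proof.
by apply/seteqP; split=> s; rewrite /preimage /zariski_subbase /= rmorph1.
Qed.

Lemma fin_gen_sub_extend (F : Fbar A) (G : Fbar B) :
  fin_gen G -> G `<=` extend f_inj F ->
  exists H : Fbar A, [/\ fin_gen H, H `<=` F & G `<=` extend f_inj H].
Proof.
move=> [Y finY GY] GF.
have YF : Y `<=` lincomb (frac_map f_inj @` F).
  by apply: subset_trans GF; rewrite GY; exact: sub_lincomb.
have [X [finX XF YX]] := finite_sub_lincomb_image finY YF.
have [x Fx x0] := Fbar_neq0 F.
(* X may span the zero module; adjoining x makes the span nonzero. *)
have finxX : finite_set (x |` X) by rewrite finite_setU; split.
have [H finH HE] := fin_gen_span finxX (or_introl erefl) x0.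
exists H; split=> //.
  by rewrite HE; apply: lincomb_min => z [->|/XF].
rewrite GY; apply: lincomb_min => y /YX; apply: lincomb_le.
apply: image_subset; rewrite HE.
by move=> z Xz; apply: sub_lincomb; right.
Qed.

Lemma finite_type_sigma (s : SStar B) :
  finite_type s -> finite_type (sigma f_inj s).
Proof.
move=> fts F; apply/seteqP; split=> [x|x [H [_ HF]]]; last exact: sstar_le.
rewrite /= {1}/preimage /= fts => -[G [finG GF] sGx].
have [H [finH HF GH]] := fin_gen_sub_extend finG GF.
by exists H => //; exact: (sstar_le GH).
Qed.

End Sigma.

Theorem proposition3p1 (A B : idomainType) (f : {rmorphism A -> B})
    (f_inj : injective f) :
  continuous (sigma f_inj : SStar B -> SStar A) /\
  (forall s : SStar B, finite_type s -> finite_type (sigma f_inj s)).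
Proof.
split; last exact: finite_type_sigma.
apply: continuous_zariski_subbase => F.
by rewrite preimage_zariski_subbase; exact: open_zariski_subbase.
Qed.
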